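(* Let $n\ge 2$ be an integer and let $N$ be an integer with $N\ge \frac{25}{19}n+43$. Then $P_N^3\to(\mathcal{C}_{\le 8},P_n)$. Consequently $\hat{R}(\mathcal{C},P_n)\le \hat{R}(\mathcal{C}_{\le 8},P_n)\le \frac{75}{19}n+O(1)$.
   Context: $P_N^3$ is the graph on vertex set $\{1,\dots,N\}$ in which $i,j$ are adjacent iff $1\le|i-j|\le 3$. For a family of graphs $\mathcal{F}$ and a graph $H$, $G\to(\mathcal{F},H)$ means every red/blue coloring of $E(G)$ contains a red copy of some member of $\mathcal{F}$ or a blue copy of $H$. $\hat{R}(\mathcal{F},H)=\min\{|E(G)|: G\to(\mathcal{F},H)\}$. $P_n$ is the path on $n$ vertices, $\mathcal{C}$ the family of all cycles, $\mathcal{C}_{\le m}$ the family of all cycles of length at most $m$. *)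

(* Defs.v *)
From mathcomp Require Import all_boot.
Set Implicit Arguments. Unset Strict Implicit. Unset Printing Implicit Defensive.

(* A graph is an edge relation [e : rel T] on a finite vertex type T.
   A red/blue edge colouring assigns a boolean to each unordered pair
   {u,v} (true = red, false = blue); only values on edges matter. *)
Definition colouring (T : finType) := {set T} -> bool.

Definition red_edge (T : finType) (e : rel T) (c : colouring T) : rel T :=
  fun u v => e u v && c [set u; v].
Definition blue_edge (T : finType) (e : rel T) (c : colouring T) : rel T :=
  fun u v => e u v && ~~ c [set u; v].

Definition has_red_cycle (T : finType) (e : rel T) (c : colouring T)
    (F : nat -> bool) : Prop :=
  exists s : seq T, [/\ 3 <= size s, F (size s), uniq s & cycle (red_edge e c) s].

Definition has_blue_path (T : finType) (e : rel T) (c : colouring T) (n : nat) : Prop :=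
  exists s : seq T, [/\ size s = n, uniq s &
    match s with [::] => True | x :: p => path (blue_edge e c) x p end].

Definition arrows (T : finType) (e : rel T) (F : nat -> bool) (n : nat) : Prop :=
  forall c : colouring T, has_red_cycle e c F \/ has_blue_path e c n.

Definition cycles_le (m : nat) : nat -> bool := fun k => k <= m.
Definition all_cycles : nat -> bool := fun _ => true.

(* P_N^3 on vertices 'I_N (= {0,...,N-1}, a shift of {1,...,N}):
   i ~ j iff 1 <= |i - j| <= 3. *)
Definition P3 (N : nat) : rel 'I_N :=
  fun i j => [&& i != j, (i <= j + 3) & (j <= i + 3)].

Arguments P3 N : clear implicits.

Definition edges (T : finType) (e : rel T) : {set {set T}} :=
  [set [set p.1; p.2] | p in [set p : T * T | e p.1 p.2]].

(* Main.v *)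
Require Import Defs.
From mathcomp Require Import all_boot zify.

(** Scan the vertices from left to right, keeping a window of the last three of
    them. If red has no cycle of length at most 6, then what matters about the
    colouring so far is the red distances inside the window, since they decide
    which colours the three edges of the next vertex may take. What matters
    about a blue path is its end in the window, the window vertices it misses
    and its length. Each new vertex [x] can prolong a path by [x], by [x, u] or
    by [x, u, w] with [u], [w] missed window vertices. So the longest blue paths
    evolve by a finite max-plus system driven by the colours, and a finite
    computation shows that the system keeps returning, within 6 steps, to one of
    12 configurations while the path grows at rate at least 10/13, which exceeds
    19/25. *)

Set Implicit Arguments. Unset Strict Implicit. Unset Printing Implicit Defensive.

(** * The finite system of red distances and blue paths *)

(* Position [u < 3] of the window at time [i] denotes the vertex [i - u]. A triple
   holds upper bounds for the red distances of the pairs 01, 02, 12; the value 5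
   carries no information, and the value 1 is exact. *)
Definition triple : Type := nat * nat * nat.

Definition dist (d : triple) (u v : nat) : nat :=
  if u == v then 0
  else match u + v with 1 => d.1.1 | 2 => d.1.2 | _ => d.2 end.

(* Item [u] of a member is the colour (true = red) of the edge from the new vertex to
   position [u]. *)
Definition colours : seq (seq bool) :=
  let b := [:: true; false] in
  [seq x :: s | x <- b, s <- [seq [:: y; z] | y <- b, z <- b]].

Definition red_at (r : seq bool) (u : nat) : bool := nth false r u.

(** Two red edges to vertices at red distance at most 4 would close a red cycle of length at most
    6. *)
Definition admissible (d : triple) (r : seq bool) : bool :=
  all (fun u =>
    all (fun v => [&& u < v, red_at r u & red_at r v] ==> (5 <= dist d u v))
        (iota 0 3)) (iota 0 3).

Definition dist_new (d : triple) (r : seq bool) (u : nat) : nat :=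
  foldr minn 5 [seq (dist d v u).+1 | v <- iota 0 3 & red_at r v].

Definition dist_step (d : triple) (r : seq bool) : triple :=
  (dist_new d r 0, dist_new d r 1,
   minn (dist d 0 1) (dist_new d r 0 + dist_new d r 1)).

(* [(l, fs, k)]: a blue path ends at position [l], misses the positions [fs], and
   13 times its length exceeds a common base value by at least [k]. *)
Definition entry : Type := nat * seq nat * nat.

Definition slide (l : nat) (fs : seq nat) (k : nat) : seq entry :=
  if l < 3 then [:: (l, [seq u <- fs | u < 3], k)] else [::].

(* The new vertex has position 0 and shifts the others by one; it is skipped, or
   the path is prolonged by the new vertex, then possibly by [u], then by [w]. *)
Definition moves (d : triple) (r : seq bool) (e : entry) : seq entry :=
  let: (l, fs, k) := e in
  slide l.+1 (0 :: map succn fs) k ++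
  if red_at r l then [::] else
  slide 0 (map succn fs) (k + 13) ++
  flatten [seq slide u.+1 [seq v.+1 | v <- fs & v != u] (k + 26) ++
    flatten [seq slide w.+1 [seq v.+1 | v <- fs & (v != u) && (v != w)] (k + 39)
            | w <- fs & (w != u) && (dist d u w != 1)]
          | u <- fs & ~~ red_at r u].

Definition weaker (e f : entry) : bool :=
  [&& e.1.1 == f.1.1, all (mem f.1.2) e.1.2 & e.2 <= f.2].

Definition prune (s : seq entry) : seq entry :=
  foldr (fun e t => if has (weaker e) t then t
                    else e :: [seq f <- t | ~~ weaker f e]) [::] s.

Definition entries_step (d : triple) (r : seq bool) (s : seq entry) : seq entry :=
  prune (flatten [seq moves d r e | e <- s]).

Definition node : Type := triple * seq entry.

(** Upper bounds may be weakened, but never away from 1: any other value licenses a blue edge in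
    [moves]. *)
Definition coarser (d d' : triple) : bool :=
  let ok x y := (x <= y) && ((x == 1) == (y == 1)) in
  [&& ok d.1.1 d'.1.1, ok d.1.2 d'.1.2 & ok d.2 d'.2].

(* The term [10 * j] charges 10 per step for the [j] steps made since the base value
   was fixed. The conditionals below replace [&&], [||] and [==>], both of whose
   arguments [vm_compute] would evaluate. *)
Definition covers (j : nat) (x q : node) : bool :=
  if coarser x.1 q.1 then
    all (fun e : entry => has (weaker (e.1.1, e.1.2, e.2 + 10 * j)) x.2) q.2
  else false.

Definition step (x : node) (r : seq bool) : node :=
  (dist_step x.1 r, entries_step x.1 r x.2).

Fixpoint returns (S : seq node) (fuel j : nat) (x : node) : bool :=
  if has (covers j x) S then true
  else if fuel is k.+1 then
    all (fun r => if admissible x.1 r then returns S k j.+1 (step x r) else true)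
        colours
  else false.

(** Empty entry lists are excluded so that reaching a node always yields a path. *)
Definition recurs (S : seq node) (fuel : nat) : bool :=
  all (fun x : node => ~~ nilp x.2 &&
    all (fun r => if admissible x.1 r then returns S fuel 1 (step x r) else true)
        colours) S.

(* Here [r] lists the colours of the pairs 01, 02, 12. The value 200 is generous, so
   that recurrent nodes are reached soon; an additive constant pays for it. *)
Definition start (r : seq bool) : node :=
  let f u := if red_at r u then 1 else 5 in
  ((f 0, f 1, f 2),
   [:: (0, [:: 1; 2], 200); (1, [:: 0; 2], 200); (2, [:: 0; 1], 200)]).

(* Found by a greedy computer search for weak nodes that preserve the growth rate. *)
Definition recurrent_nodes : seq node := [::
  ((1, 1, 4), [:: (2, [:: 1], 39); (2, [:: 0], 52); (1, [:: 0], 52)]);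
  ((5, 5, 1), [:: (2, [:: 0], 37); (1, [::], 50); (0, [::], 63)]);
  ((4, 1, 1), [:: (2, [::], 36); (1, [::], 49); (0, [::], 62)]);
  ((5, 1, 5), [:: (2, [:: 0], 37); (1, [::], 50); (0, [::], 63)]);
  ((1, 5, 5), [:: (2, [::], 39); (1, [:: 0], 52); (0, [::], 52)]);
  ((1, 1, 4), [:: (2, [:: 1], 40); (2, [:: 0], 40); (1, [:: 0], 53)]);
  ((3, 1, 1), [:: (2, [:: 0; 1], 40); (1, [:: 0], 40); (0, [::], 53)]);
  ((1, 2, 1), [:: (2, [:: 1], 41); (2, [:: 0], 41); (1, [::], 41); (0, [:: 1], 54)]);
  ((5, 5, 1), [:: (2, [::], 54); (2, [:: 0; 1], 41); (1, [::], 67); (0, [::], 54)]);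
  ((5, 5, 5), [:: (2, [::], 54); (1, [::], 54); (0, [::], 67)]);
  ((1, 1, 4), [:: (2, [:: 0], 44); (1, [:: 0], 57)]);
  ((1, 1, 5), [:: (2, [::], 63); (1, [:: 0], 50); (0, [::], 50)])].

Lemma recurs_recurrent_nodes : recurs recurrent_nodes 5.
Proof. by vm_compute. Qed.

Lemma returns_start : all (returns recurrent_nodes 3 0 \o start) colours.
Proof. by vm_compute. Qed.

Lemma foldr_minn_mem c s : foldr minn c s \in c :: s.
Proof.
elim: s => [|x s IHs] /=; first by rewrite mem_head.
rewrite /minn; case: ifP => _; first by rewrite !inE eqxx orbT.
by move: IHs; rewrite !inE => /orP[->|->]; rewrite ?orbT.
Qed.

Lemma foldr_minn_leq c s x : x \in s -> foldr minn c s <= x.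
Proof.
elim: s => //= y s IHs; rewrite inE => /orP[/eqP->|/IHs]; first exact: geq_minl.
by apply: leq_trans; apply: geq_minr.
Qed.

Definition adj3 (i j : nat) : bool := [&& i != j, i <= j + 3 & j <= i + 3].

(** * Soundness for red distances *)

Section Soundness.

Variables (N : nat) (red : rel nat).
Hypothesis red_sym : symmetric red.

Definition red3 (i j : nat) : bool := adj3 i j && red i j.
Definition blue3 (i j : nat) : bool := adj3 i j && ~~ red i j.

Hypothesis no_short_cycle : forall s : seq nat,
  3 <= size s <= 8 -> uniq s -> all (gtn N) s -> ~~ cycle red3 s.

Lemma adj3_sym : symmetric adj3.
Proof. by move=> i j; rewrite /adj3; lia. Qed.

Lemma red3_sym : symmetric red3.
Proof. by move=> i j; rewrite /red3 adj3_sym red_sym. Qed.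

Lemma blue3_sym : symmetric blue3.
Proof. by move=> i j; rewrite /blue3 adj3_sym red_sym. Qed.

(** Confinement to vertices up to [i] keeps later vertices off the walk, so that they can close it
    to a cycle. *)
Definition red_walk (i k a b : nat) : Prop :=
  exists s, [/\ path red3 a s, last a s = b, size s <= k & all (geq i) (a :: s)].

Lemma red_walk0 i k a : a <= i -> red_walk i k a a.
Proof. by move=> lai; exists [::]; split=> //=; rewrite lai. Qed.

Lemma red_walk_sym i k a b : red_walk i k a b -> red_walk i k b a.
Proof.
case=> s [ps <- szs ls]; exists (rev (belast a s)); split.
- by rewrite rev_path (eq_path (e' := red3)) // => x y; rewrite red3_sym.
- by case: s {ps szs ls} => //= x s; rewrite rev_cons last_rcons.
- by rewrite size_rev size_belast.
- have: all (geq i) (rev (a :: s)) by rewrite all_rev.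
  by rewrite lastI rev_rcons.
Qed.

Lemma red_walk_trans i k l a b c :
  red_walk i k a b -> red_walk i l b c -> red_walk i (k + l) a c.
Proof.
move=> [s [ps <- szs ls]] [t [pt <- szt lt]]; exists (s ++ t); split.
- by rewrite cat_path ps.
- by rewrite last_cat.
- by rewrite size_cat leq_add.
- by move: ls lt; rewrite /= all_cat => /andP[-> ->] /andP[_ ->].
Qed.

Lemma red_walk_leq i j k l a b :
  i <= j -> k <= l -> red_walk i k a b -> red_walk j l a b.
Proof.
move=> lij lkl [s [ps e szs ls]]; exists s; split=> //; first exact: leq_trans lkl.
by apply: sub_all ls => x /= /leq_trans; apply.
Qed.

Lemma red_walk1 i a b : a <= i -> b <= i -> red3 a b -> red_walk i 1 a b.
Proof. by move=> la lb ab; exists [:: b]; split=> //=; rewrite ?ab ?la ?lb. Qed.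

Lemma red_walk_long i x a b k :
  i < x < N -> a != b -> red3 x a -> red3 x b -> red_walk i k a b -> 6 < k.
Proof.
case/andP=> lix ltxN nab xa xb [s [ps es szs ls]]; rewrite ltnNge; apply/negP=> lk.
(* The walk contains a simple path, which [x] closes to a cycle on at most [k + 2 <= 8] vertices. *)
case: (shortenP ps) es => s' ps' us' ss' es.
have szs' : size s' <= size s by apply: uniq_leq_size => //; case/andP: us'.
have ls' : all (geq i) (a :: s').
  case/andP: ls => la ls; apply/andP; split=> //; apply/allP=> y /ss' ys.
  exact: (allP ls).
suff: ~~ cycle red3 (x :: a :: s') by rewrite /= xa rcons_path ps' es red3_sym xb.
apply: no_short_cycle.
- move: szs szs' lk nab es => /=; case: (s') => [|? ?] /=; last by lia.
  by move=> _ _ _ /eqP.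
- by rewrite cons_uniq us' andbT; apply/negP=> /(allP ls') /=; rewrite leqNgt lix.
- apply/andP; split=> //; apply: sub_all ls' => y ly.
  by apply: leq_ltn_trans ltxN; apply: leq_trans ly (ltnW lix).
Qed.

Definition dist_ok (i u v k : nat) : Prop :=
  (k < 5 -> red_walk i k (i - u) (i - v)) /\ (red (i - u) (i - v) -> k = 1).

Definition dists_ok (i : nat) (d : triple) : Prop :=
  [/\ dist_ok i 0 1 d.1.1, dist_ok i 0 2 d.1.2 & dist_ok i 1 2 d.2].

Lemma dist_ok_sym i u v k : dist_ok i u v k -> dist_ok i v u k.
Proof.
by move=> [w e]; split=> [/w/red_walk_sym//|]; rewrite red_sym.
Qed.

Lemma dists_okP i d u v :
  dists_ok i d -> u < 3 -> v < 3 -> u != v -> dist_ok i u v (dist d u v).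
Proof.
move=> [d01 d02 d12].
by case: u => [|[|[|u]]] //; case: v => [|[|[|v]]] //= _ _ _;
  rewrite /dist //=; apply: dist_ok_sym.
Qed.

Lemma dists_ok_walk i d u v : dists_ok i d -> u < 3 -> v < 3 ->
  dist d u v < 5 -> red_walk i (dist d u v) (i - u) (i - v).
Proof.
move=> dok lu lv; have [->|nuv] := eqVneq u v.
  by move=> _; apply: red_walk0; apply: leq_subr.
by case: (dists_okP dok lu lv nuv).
Qed.

Definition new_colours (i : nat) : seq bool := [seq red i.+1 (i - u) | u <- iota 0 3].

Lemma red_at_new i u : u < 3 -> red_at (new_colours i) u = red i.+1 (i - u).
Proof. by case: u => [|[|[|]]]. Qed.

Lemma new_colours_in i : new_colours i \in colours.
Proof. by rewrite /new_colours /=; do 3!case: (red _ _). Qed.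

Lemma adj3_new i u : 1 < i -> u < 3 -> adj3 i.+1 (i - u).
Proof. by rewrite /adj3; lia. Qed.

(** The bound [1 < i] makes truncated subtraction injective on the window. *)
Lemma adj3_window i u v : 1 < i -> u < 3 -> v < 3 -> u != v -> adj3 (i - u) (i - v).
Proof. by rewrite /adj3; lia. Qed.

Lemma admissible_new i d : 1 < i -> i.+1 < N -> dists_ok i d ->
  admissible d (new_colours i).
Proof.
move=> i2 iN dok; apply/allP=> u; rewrite mem_iota => lu.
apply/allP=> v; rewrite mem_iota => lv; apply/implyP.
rewrite !red_at_new // => /and3P[uv ru rv]; rewrite leqNgt; apply/negP=> ld.
have w := dists_ok_walk dok lu lv ld.
suff: 6 < dist d u v by lia.
apply: (@red_walk_long i i.+1) w; rewrite ?ltnSn /red3 ?adj3_new //; lia.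
Qed.

Lemma dist_new_ok i d u : 1 < i -> u < 2 -> dists_ok i d ->
  dist_ok i.+1 0 u.+1 (dist_new d (new_colours i) u).
Proof.
move=> i2 lu dok; rewrite /dist_ok subn0 subSS /dist_new.
set s := map _ _.
have s0 x : x \in s -> 0 < x by case/mapP=> v _ ->.
have m := foldr_minn_mem 5 s; split=> [l5|r].
  move: m l5; rewrite inE => /orP[/eqP->//|/mapP[v]].
  rewrite mem_filter mem_iota add0n => /andP[rv /= lv] -> l5.
  have lu3 : u < 3 by apply: leq_trans lu _.
  have w := dists_ok_walk dok lv lu3 (ltnW l5).
  rewrite -[(dist d v u).+1]add1n.
  apply: red_walk_trans (red_walk_leq (leqnSn i) (leqnn _) w).
  apply: red_walk1 => //; first by lia.
  by rewrite /red3 adj3_new // -red_at_new.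
(* The red edge itself contributes 1 to the minimum, and all terms are positive. *)
apply/eqP; rewrite eqn_leq; apply/andP; split.
  apply: foldr_minn_leq; apply/mapP; exists u; last by rewrite /dist eqxx.
  rewrite mem_filter mem_iota red_at_new ?r /=; last by apply: leq_trans lu _.
  by rewrite add0n (leq_trans lu).
by move: m; rewrite inE => /orP[/eqP->//|/s0].
Qed.

Lemma dist_new_gt0 d r u : 0 < dist_new d r u.
Proof.
have := foldr_minn_mem 5 [seq (dist d v u).+1 | v <- iota 0 3 & red_at r v].
by rewrite -/(dist_new d r u) inE => /orP[/eqP->//|/mapP[v _ ->]].
Qed.

Lemma dist_step_ok i d : 1 < i -> dists_ok i d ->
  dists_ok i.+1 (dist_step d (new_colours i)).
Proof.
move=> i2 dok; have n0 := @dist_new_ok i d 0 i2 isT dok.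
have n1 := @dist_new_ok i d 1 i2 isT dok; split=> //=.
case: (dok) => [[w01 r01] _ _].
rewrite /dist_ok !subSS; split=> [|/r01 e].
  rewrite /minn; case: ifP => _ l5; first exact: red_walk_leq (w01 l5).
  have [[w0 _] [w1 _]] := (n0, n1).
  apply: red_walk_trans (red_walk_sym (w0 _)) (w1 _).
    by apply: leq_ltn_trans l5; apply: leq_addr.
  by apply: leq_ltn_trans l5; apply: leq_addl.
(* A detour through the new vertex counts at least 2, so the value 1 survives. *)
have := dist_new_gt0 d (new_colours i) 0; have := dist_new_gt0 d (new_colours i) 1.
by rewrite /minn [dist d 0 1]e; case: ifP => // /negbT; lia.
Qed.

Lemma coarser_ok i d d' : coarser d d' -> dists_ok i d -> dists_ok i d'.
Proof.
have ok u v k l :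
    (k <= l) && ((k == 1) == (l == 1)) -> dist_ok i u v k -> dist_ok i u v l.
  case/andP=> lkl /eqP e [w r]; split=> [l5|/r k1].
    by apply: red_walk_leq (w (leq_ltn_trans lkl l5)).
  by apply/eqP; rewrite -e k1.
by case/and3P=> o1 o2 o3 [d1 d2 d3]; split; [apply: ok d1|apply: ok d2|apply: ok d3].
Qed.

(** * Blue paths behind the entries *)

Definition tracing (i h : nat) (t fs : seq nat) : bool :=
  [&& path blue3 h t, uniq (h :: t), all (geq i) (h :: t)
    & all (fun u => i - u \notin h :: t) fs].

(* 207 = 20 + 200 - 13 accommodates the one-vertex paths of [start] at time 2. *)
Definition traced (i b : nat) (e : entry) : Prop :=
  exists2 t, tracing i (i - e.1.1) t e.1.2 & b + e.2 <= 13 * (size t).+1 + 207.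

Definition realized (i b : nat) (e : entry) : Prop :=
  [/\ e.1.1 < 3, all (gtn 3) e.1.2 & traced i b e].

Lemma slide_ok i b l fs k e :
  traced i b (l, fs, k) -> e \in slide l fs k -> realized i b e.
Proof.
rewrite /slide; case: ifP => // l3 [t tr le]; rewrite inE => /eqP->.
split=> //=; first exact: filter_all.
exists t => //=; case/and4P: tr => p u a f; apply/and4P; split=> //.
by apply/allP=> v; rewrite mem_filter => /andP[_ /(allP f)].
Qed.

Lemma tracing_shift i h t fs :
  tracing i h t fs -> tracing i.+1 h t (0 :: map succn fs).
Proof.
case/and4P=> p u a f; apply/and4P; split=> //.
  by apply: sub_all a => x /= /leqW.
rewrite /= subn0; apply/andP; split; first by apply/negP=> /(allP a) /=; rewrite ltnn.
by apply/allP=> _ /mapP[v vf ->]; rewrite subSS; apply: (allP f).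
Qed.

(** Paths are listed from their growing end; a missed vertex is fresh, so it can be consed. *)
Lemma tracing_extend i h t fs fs' u :
    tracing i h t fs -> u \in fs -> blue3 (i - u) h ->
    {in fs', forall v, v \in fs /\ i - v != i - u} ->
  tracing i (i - u) (h :: t) fs'.
Proof.
case/and4P=> p un a f uf b sub; apply/and4P; split.
- by rewrite /= b.
- by rewrite cons_uniq un (allP f).
- by apply/andP; split=> //=; apply: leq_subr.
- by apply/allP=> v /sub[vf ne]; rewrite inE negb_or ne (allP f).
Qed.

Lemma moves_ok i b d e f : 1 < i -> dists_ok i d -> realized i b e ->
  f \in moves d (new_colours i) e -> realized i.+1 b f.
Proof.
case: e => [[l fs] k] i2 dok [/= l3 fs3 [t tr le]].
have tr0 := tracing_shift tr.
rewrite /moves mem_cat => /orP[|].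
  by apply: slide_ok; exists t; rewrite //= subSS.
rewrite red_at_new //; case: ifPn => [|bl]; first by rewrite in_nil.
(* After the shift the new vertex is itself a missed one, at position 0, so each prolongation is a
   [tracing_extend]. *)
have tr1 : tracing i.+1 (i.+1 - 0) (i - l :: t) (map succn fs).
  apply: tracing_extend tr0 (mem_head _ _) _ _.
    by rewrite /blue3 subn0 adj3_new.
  by move=> _ /mapP[v vf ->]; rewrite inE map_f // orbT; split=> //; lia.
rewrite -cat1s mem_cat => /orP[|].
  apply: (@slide_ok _ _ 0 (map succn fs) (k + 13)); exists (i - l :: t) => //=.
  by move: le => /=; lia.
case/flatten_mapP=> u; rewrite mem_filter => /andP[bu uf].
have u3 : u < 3 := allP fs3 u uf.
rewrite red_at_new // in bu.
have tr2 : tracing i.+1 (i.+1 - u.+1) (i.+1 - 0 :: i - l :: t)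
    [seq v.+1 | v <- fs & v != u].
  apply: tracing_extend tr1 (map_f _ uf) _ _.
    by rewrite subn0 subSS blue3_sym /blue3 adj3_new.
  move=> x /mapP[v]; rewrite mem_filter => /andP[nvu vf] {x}->.
  have v3 : v < 3 := allP fs3 v vf.
  by rewrite map_f //; split=> //; lia.
rewrite mem_cat => /orP[|].
  by apply: slide_ok; exists (i.+1 - 0 :: i - l :: t) => //; move: le => /=; lia.
case/flatten_mapP=> w; rewrite mem_filter => /andP[/andP[nwu dw] wf].
have w3 : w < 3 := allP fs3 w wf.
apply: slide_ok; exists (i.+1 - u.+1 :: i.+1 - 0 :: i - l :: t);
  last by move: le => /=; lia.
apply: (tracing_extend (u := w.+1)) tr2 _ _ _.
- by rewrite map_f // mem_filter nwu.
- rewrite !subSS /blue3 adj3_window //= red_sym.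
  case: (dists_okP dok u3 w3 _) => [|_ r]; first by rewrite eq_sym.
  by apply/negP=> /r /eqP; apply/negP.
- move=> x /mapP[v]; rewrite mem_filter => /andP[/andP[nvu nvw] vf] {x}->.
  have v3 : v < 3 := allP fs3 v vf.
  by rewrite map_f ?mem_filter ?nvu //; split=> //; lia.
Qed.

Lemma mem_prune s : {subset prune s <= s}.
Proof.
elim: s => //= e s IHs f; case: ifP => _; first by move/IHs; rewrite inE orbC => ->.
by rewrite !inE mem_filter => /orP[->//|/andP[_ /IHs->]]; rewrite orbT.
Qed.

Definition node_ok (i b : nat) (x : node) : Prop :=
  dists_ok i x.1 /\ {in x.2, forall e, realized i b e}.

Lemma step_ok i b x : 1 < i -> node_ok i b x ->
  node_ok i.+1 b (step x (new_colours i)).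
Proof.
move=> i2 [dok eok]; split; first exact: dist_step_ok.
by move=> f /mem_prune/flatten_mapP[e /eok]; apply: moves_ok.
Qed.

Lemma weaker_realized i b j (e f : entry) :
  weaker (e.1.1, e.1.2, e.2 + j) f -> realized i b f -> realized i (b + j) e.
Proof.
case/and3P=> /= /eqP el /allP ef le [l3 fs3 [t tr lt]]; split.
- by rewrite el.
- by apply/allP=> u /ef; apply: (allP fs3).
exists t; last by lia.
case/and4P: tr => p u a g; rewrite el; apply/and4P; split=> //.
by apply/allP=> v /ef; apply: (allP g).
Qed.

Lemma covers_ok i b j x q : covers j x q -> node_ok i b x -> node_ok i (b + 10 * j) q.
Proof.
rewrite /covers; case: ifP => // co /allP cov [dok eok]; split.
  exact: coarser_ok dok.
by move=> e /cov/hasP[f /eok fok w]; apply: weaker_realized fok.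
Qed.

Lemma returns_ok S k j x i b : returns S k j x -> node_ok i b x ->
    1 < i -> i + k < N ->
  exists q i', [/\ q \in S, i <= i' <= i + k
    & node_ok i' (b + 10 * (j + (i' - i))) q].
Proof.
elim: k j x i => [|k IHk] j x i; rewrite /returns -/returns;
  case: ifP => [/hasP[q qS cov] _ xok i2 iN|_] //.
- by exists q, i; rewrite subnn !addn0 leqnn; split=> //; apply: covers_ok xok.
- by exists q, i; rewrite subnn !addn0 leqnn leq_addr; split=> //; apply: covers_ok xok.
move=> /allP/(_ _ (new_colours_in i)) ret xok i2 iN; move: ret.
rewrite admissible_new //; last by case: xok.
  move=> /IHk/(_ (step_ok i2 xok))[| |q [i' [qS li ok]]]; try by lia.
  exists q, i'; split=> //; first by lia.
  by have -> : j + (i' - i) = j.+1 + (i' - i.+1) by lia.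
by lia.
Qed.

(** * Iterating the computation along the vertices *)

Definition first_colours : seq bool :=
  [seq red (2 - u.1) (2 - u.2) | u <- [:: (0, 1); (0, 2); (1, 2)]].

Lemma start_ok : node_ok 2 20 (start first_colours).
Proof.
have ok u v : u < 3 -> v < 3 -> u != v ->
    dist_ok 2 u v (if red (2 - u) (2 - v) then 1 else 5).
  move=> lu lv nuv; rewrite /dist_ok; case: ifP => r; split=> // _.
  by apply: red_walk1; rewrite ?leq_subr // /red3 adj3_window.
split; first by split; apply: ok.
by move=> e; rewrite !inE => /or3P[] /eqP->; split=> //; exists [::].
Qed.

Lemma recurrent_reached m : m + 7 <= N ->
  exists q i, [/\ q \in recurrent_nodes, m <= i <= m + 6, 1 < i
    & node_ok i (10 * i) q].
Proof.
elim: m => [|m IHm] mN.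
  have sin : first_colours \in colours.
    by rewrite /first_colours /=; do 3!case: (red _ _).
  have [||q [i [qS li ok]]] := returns_ok (allP returns_start _ sin) start_ok;
    try by lia.
  exists q, i; split=> //; try by lia.
  by have <- : 20 + 10 * (0 + (i - 2)) = 10 * i by lia.
have [|q [i [qS li i2 ok]]] := IHm; first by lia.
have [lmi|lim] := ltnP m i; first by exists q, i; split=> //; lia.
(* Here [i = m]; one step and then fuel 5 lead to a time between [m + 1] and [m + 6]. *)
have /andP[_ /allP/(_ _ (new_colours_in i))] := allP recurs_recurrent_nodes _ qS.
rewrite admissible_new //; [| by lia | by case: ok].
move=> /returns_ok/(_ (step_ok i2 ok))[||q' [i' [qS' li' ok']]]; try by lia.
exists q', i'; split=> //; try by lia.
by have <- : 10 * i + 10 * (1 + (i' - i.+1)) = 10 * i' by lia.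
Qed.

Lemma long_blue_path : 7 <= N -> exists h t,
  [/\ path blue3 h t, uniq (h :: t), all (gtn N) (h :: t)
    & 10 * N <= 13 * (size t).+1 + 277].
Proof.
(* Stopping at some [i >= N - 7] loses at most 70, and 277 = 207 + 70. *)
move=> N7; have [|q [i [qS li i2 [_ eok]]]] := @recurrent_reached (N - 7); first by lia.
have /andP[q0 _] := allP recurs_recurrent_nodes _ qS.
case: q.2 q0 eok => // e es _ /(_ _ (mem_head _ _))[_ _ [t /and4P[p u a _] le]].
exists (i - e.1.1), t; split=> //; last by lia.
by apply: sub_all a => x /= lx; apply: leq_ltn_trans lx _; lia.
Qed.

End Soundness.

(** * Transfer to colourings of the cube of a path *)

Section ColouredP3.

Variables (M : nat) (c : colouring 'I_M.+1).
Let G := P3 M.+1.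

Definition nat_red (i j : nat) : bool := c [set inord i; inord j].

Lemma nat_red_sym : symmetric nat_red.
Proof. by move=> i j; rewrite /nat_red setUC. Qed.

Lemma P3_inord : {in gtn M.+1 &, forall i j, G (inord i) (inord j) = adj3 i j}.
Proof. by move=> i j li lj; rewrite /G /P3 -val_eqE /= !inordK. Qed.

Lemma inord_inj : {in gtn M.+1 &, injective (@inord M)}.
Proof. by move=> i j li lj /(congr1 val); rewrite /= !inordK. Qed.

Lemma inord_uniq s : all (gtn M.+1) s -> uniq s -> uniq (map (@inord M) s).
Proof.
move=> /allP ls us; rewrite map_inj_in_uniq // => i j /ls li /ls lj.
exact: inord_inj.
Qed.

Lemma nat_red3 : {in gtn M.+1 &,
  {homo @inord M : i j / red3 nat_red i j >-> red_edge G c i j}}.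
Proof. by move=> i j li lj /andP[a r]; rewrite /red_edge P3_inord ?a. Qed.

Lemma nat_blue3 : {in gtn M.+1 &,
  {homo @inord M : i j / blue3 nat_red i j >-> blue_edge G c i j}}.
Proof. by move=> i j li lj /andP[a r]; rewrite /blue_edge P3_inord ?a. Qed.

Lemma P3_arrows_at n : 25 * n + 43 * 19 <= 19 * M.+1 ->
  has_red_cycle G c (cycles_le 8) \/ has_blue_path G c n.
Proof.
move=> le.
(* Bounded lengths make the existence of a short red cycle decidable. *)
pose short_cycle (k : 'I_9) :=
  [exists s : k.-tuple 'I_M.+1, [&& 2 < k, uniq s & cycle (red_edge G c) s]].
case: (boolP [exists k, short_cycle k])
  => [/existsP[k /existsP[s /and3P[k3 us cs]]]|ncyc].
  left; exists s; split; rewrite ?size_tuple //.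
  by rewrite /cycles_le -ltnS; apply: ltn_ord.
right; have [||h [t [p u a sz]]] := @long_blue_path M.+1 nat_red nat_red_sym.
- move=> s /andP[s3 s8] us ls; apply: contra ncyc => cs.
  apply/existsP; exists (Ordinal (s8 : size s < 9)); apply/existsP.
  have sz : size (map (@inord M) s) == size s by rewrite size_map.
  exists (Tuple sz); rewrite /= s3 inord_uniq //=.
  exact: (homo_cycle_in nat_red3 ls cs).
- by lia.
have pb : path (blue_edge G c) (inord h) (map (@inord M) t).
  exact: (homo_path_in nat_blue3 a p).
exists (take n (map (@inord M) (h :: t))); split.
(* As 250/19 > 13, [10 * M.+1] is at least [13 * n + 430], and 430 > 277. *)
- by rewrite size_takel // size_map /=; lia.
- by apply: take_uniq; apply: inord_uniq.
- by case: n {le} => //= n; apply: take_path.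
Qed.

End ColouredP3.

Lemma P3_arrows n N : 25 * n + 43 * 19 <= 19 * N -> arrows (P3 N) (cycles_le 8) n.
Proof. by case: N => [|M] le c; [lia | apply: P3_arrows_at]. Qed.

(** * The size Ramsey bound *)

Lemma arrows_all_cycles (T : finType) (e : rel T) F n :
  arrows e F n -> arrows e all_cycles n.
Proof.
by move=> arr c; case: (arr c) => [[s [s3 _ us cs]]|]; [left; exists s | right].
Qed.

Lemma P3_sym N : symmetric (P3 N).
Proof. by move=> i j; rewrite /P3 eq_sym andbCA andbA andbC andbA andbC. Qed.

Lemma P3_irr N : irreflexive (P3 N).
Proof. by move=> i; rewrite /P3 eqxx. Qed.

Lemma card_edges_P3 N : #|edges (P3 N)| <= 3 * N.
Proof.
case: N => [|M].
  rewrite (_ : edges _ = set0) ?cards0 //; apply/setP=> A; rewrite inE.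
  by apply/negP=> /imsetP[[[]]].
(* An edge is coded by its smaller end and its gap minus 1; junk values of [inord] past the right
   end only enlarge the image. *)
pose f (q : 'I_M.+1 * 'I_3) : {set 'I_M.+1} := [set q.1; inord (q.1 + q.2.+1)].
have f_edge (i j : 'I_M.+1) : i < j -> P3 M.+1 i j -> [set i; j] \in f @: setT.
  move=> ij /and3P[_ _ ji]; have k3 : j - i.+1 < 3 by lia.
  apply/imsetP; exists (i, Ordinal k3) => //; rewrite /f /=.
  by rewrite (_ : i + _ = j) ?inord_val //; lia.
have sub : edges (P3 M.+1) \subset f @: setT.
  apply/subsetP=> A /imsetP[[i j]]; rewrite inE /= => e ->.
  have [ij|ji|/val_inj ij] := ltngtP i j; first exact: f_edge.
    by rewrite setUC f_edge // P3_sym.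
  by move: e; rewrite ij P3_irr.
apply: leq_trans (subset_leq_card sub) _; apply: leq_trans (leq_imset_card _ _) _.
by rewrite cardsT card_prod !card_ord mulnC.
Qed.

Theorem theorem1p3 :
  (forall n N : nat, 2 <= n -> 25 * n + 43 * 19 <= 19 * N ->
     arrows (P3 N) (cycles_le 8) n)
  /\
  (exists C : nat, forall n : nat, 2 <= n ->
     exists (k : nat) (e : rel 'I_k),
       [/\ symmetric e, irreflexive e,
           arrows e (cycles_le 8) n, arrows e all_cycles n &
           19 * #|edges e| <= 75 * n + C]).
Proof.
split=> [n N _|]; first exact: P3_arrows.
(* Rounding up adds at most 1 to [N], whence 44 = 43 + 1, with 3 edges per vertex. *)
exists (3 * 44 * 19) => n _.
pose N := ((25 * n + 43 * 19) %/ 19).+1.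
have arr : arrows (P3 N) (cycles_le 8) n.
  by apply: P3_arrows; rewrite /N; lia.
exists N, (P3 N); split=> //.
- exact: P3_sym.
- exact: P3_irr.
- exact: arrows_all_cycles arr.
- by have := card_edges_P3 N; rewrite /N; lia.
Qed.
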